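(* Let $G \curvearrowright T$ be an action by automorphisms of a countable group $G$ on a countable tree $T$ (not necessarily locally finite, not necessarily free), and suppose that every infinite geodesic $\mathbf v$ in $T$ has a finite initial segment $\sigma$ with $\mathrm{Stab}_G(\sigma) = \mathrm{Stab}_G(\mathbf v)$. Then the orbit equivalence relation $E_G^{\partial T}$ of the induced action of $G$ on the boundary $\partial T$ is Borel hyperfinite.
   Context: A tree is a connected acyclic undirected simple graph. A geodesic in $T$ is a finite or infinite injective sequence of vertices with consecutive terms adjacent. $\mathrm{Geo}(T)\subseteq V(T)^{\mathbb N}$ is the standard Borel space (Borel subset of the product space, $V(T)$ discrete) of infinite geodesics. $\mathbb N$ acts on $\mathrm{Geo}(T)$ by the shift $(v_0,v_1,v_2,\dots)\mapsto(v_1,v_2,\dots)$; the boundary $\partial T$ is the quotient $\mathrm{Geo}(T)/\mathbb N$ by the equivalence relation generated by the shift (a standard Borel space). $G$ acts on geodesics coordinatewise, this commutes with the shift, and so descends to a Borel action on $\partial T$. For a (finite or infinite) geodesic $\sigma$, $\mathrm{Stab}_G(\sigma)=\{g\in G: g\sigma=\sigma\}$ (i.e. $g$ fixes every vertex of $\sigma$). For a group action, $E_G^X$ is its orbit equivalence relation. A countable Borel equivalence relation $E$ is Borel hyperfinite if $E=\bigcup_i E_i$ for an increasing sequence $(E_i)_{i\in\mathbb N}$ of countable Borel equivalence relations each having all classes finite. *)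

(* Defs.v *)
From mathcomp Require Import all_boot.
From mathcomp Require Import boolp classical_sets cardinality measurable_structure.

Local Open Scope classical_set_scope.

Definition is_group (G : Type) (mul : G -> G -> G) (one : G) (inv : G -> G) : Prop :=
  (forall a b c, mul a (mul b c) = mul (mul a b) c) /\
  (forall a, mul one a = a) /\ (forall a, mul a one = a) /\
  (forall a, mul (inv a) a = one) /\ (forall a, mul a (inv a) = one).

Definition is_action (G V : Type) (mul : G -> G -> G) (one : G) (act : G -> V -> V) : Prop :=
  (forall x, act one x = x) /\ (forall g h x, act (mul g h) x = act g (act h x)).

Definition is_tree (V : countType) (adj : rel V) : Prop :=
  (forall x y, adj x y = adj y x) /\
  (forall x, ~~ adj x x) /\
  (forall x y, exists s : seq V, path adj x s /\ last x s = y) /\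
  (forall (x : V) (s : seq V), 2 <= size s -> uniq (x :: s) ->
      path adj x s -> ~~ adj (last x s) x).

Definition acts_by_automorphisms (G : Type) (V : countType) (adj : rel V)
    (act : G -> V -> V) : Prop :=
  forall g x y, adj (act g x) (act g y) = adj x y.

Definition geodesic (V : countType) (adj : rel V) (v : nat -> V) : Prop :=
  injective v /\ forall n, adj (v n) (v n.+1).

Definition stab_segment (G : Type) (V : Type) (act : G -> V -> V) (v : nat -> V) (n : nat)
  : set G := [set g | forall i, (i <= n)%N -> act g (v i) = v i].
Definition stab_geo (G : Type) (V : Type) (act : G -> V -> V) (v : nat -> V) : set G :=
  [set g | forall i, act g (v i) = v i].

(* Borel sets of V^N (V discrete): sigma-algebra generated by the cylinders *)
Definition cylinders (V : Type) : set (set (nat -> V)) :=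
  [set C | exists n x, C = [set f | f n = x]].
Definition borel_seq (V : Type) : set (set (nat -> V)) := smallest (sigma_algebra setT) (cylinders V).

(* equivalence relation generated by the shift *)
Definition tail_eq (V : Type) (v w : nat -> V) : Prop :=
  exists m n, forall k, v (m + k)%N = w (n + k)%N.

Definition tclass (V : countType) (adj : rel V) (v : nat -> V) : set (nat -> V) :=
  [set w | geodesic V adj w /\ tail_eq V v w].

Definition boundary (V : countType) (adj : rel V) :=
  {A : set (nat -> V) | exists v, geodesic V adj v /\ A = tclass V adj v}.

Definition boundary_borel (V : countType) (adj : rel V) : set (set (boundary V adj)) :=
  [set B | borel_seq V
      [set v | geodesic V adj v /\ exists x : boundary V adj, B x /\ sval x = tclass V adj v]].

Definition boundary2_borel (V : countType) (adj : rel V)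
  : set (set (boundary V adj * boundary V adj)) :=
  smallest (sigma_algebra setT) [set C | exists A B, boundary_borel V adj A /\ boundary_borel V adj B /\ C = A `*` B].

Definition boundary_orbit_rel (G : Type) (V : countType) (adj : rel V)
    (act : G -> V -> V) (x y : boundary V adj) : Prop :=
  exists g v, geodesic V adj v /\ sval x = tclass V adj v /\
              sval y = tclass V adj (fun k => act g (v k)).

Definition is_equivalence (X : Type) (R : X -> X -> Prop) : Prop :=
  (forall x, R x x) /\ (forall x y, R x y -> R y x) /\
  (forall x y z, R x y -> R y z -> R x z).

Definition boundary_borel_hyperfinite (V : countType) (adj : rel V)
    (E : boundary V adj -> boundary V adj -> Prop) : Prop :=
  exists En : nat -> boundary V adj -> boundary V adj -> Prop,
    (forall i, is_equivalence (boundary V adj) (En i)) /\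
    (forall i, boundary2_borel V adj [set p | En i p.1 p.2]) /\
    (forall i x, finite_set [set y | En i x y]) /\
    (forall i x y, En i x y -> En i.+1 x y) /\
    (forall x y, E x y <-> exists i, En i x y).

(* Main.v *)
(** Identify a boundary point with its ray from a base vertex [o]; two points are in the
same orbit iff some tails of their rays are [G]-translates of each other.  Record the
orbits of finite segments by countably many [G]-invariant bits.  Along a ray, greedily
choosing an infinite 0-1 word each of whose prefixes occurs infinitely often yields
decreasing, tail-invariant sets of marked positions, each cofinal.  Let [F_(k+1)] identify
two rays when their tails from the first [k]-th marker are translates of each other, and let
[F_0] be equality: the [F_k] increase to the orbit relation.  By the stabiliser hypothesis,
an [F_k]-class inside its [F_(k+1)]-class is determined by the orbit of a finite segment,
hence by a natural number [K_k].  Bounding these indices cuts the [F_k] down to an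
increasing sequence of equivalence relations with finite classes. *)
Require Import Defs.
From mathcomp Require Import all_boot.
From mathcomp Require Import boolp classical_sets cardinality measurable_structure.
Local Open Scope classical_set_scope.

(** * Closure of a sigma-algebra under countable logical operations *)

Section SigmaAlgebraPredicates.
Context {Z : Type} {S : set (set Z)} (salgS : sigma_algebra setT S).
Implicit Types P Q : Z -> Prop.

Lemma sigma_not {P} : S P -> S (fun z => ~ P z).
Proof.
case: salgS => _ SC _ /SC; congr S.
by apply/seteqP; split => z /=; [case | split].
Qed.

Lemma sigma_exists {C : countType} {P : C -> Z -> Prop} :
  (forall c, S (P c)) -> S (fun z => exists c, P c z).
Proof.
case: salgS => S0 _ SU SP.
have := SU (fun n => if unpickle n is Some c then P c else set0).
have -> : \bigcup_n (if unpickle n is Some c then P c else set0) =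
          (fun z => exists c, P c z).
  apply/seteqP; split => z /=.
    by case=> n _; case: unpickle => // c Pc; exists c.
  by case=> c Pc; exists (pickle c) => //; rewrite pickleK.
by apply=> n; case: unpickle.
Qed.

Lemma sigma_forall {C : countType} {P : C -> Z -> Prop} :
  (forall c, S (P c)) -> S (fun z => forall c, P c z).
Proof.
move=> SP; have /sigma_not := sigma_exists (fun c => sigma_not (SP c)).
congr S; apply/funext => z; apply/propext; split=> [nex c | allP [c /(_ (allP c))]//].
by apply: contrapT => nP; apply: nex; exists c.
Qed.

Lemma sigma_const (p : Prop) : S (fun=> p).
Proof.
case: salgS => S0 SC _; case: (pselect p) => hp.
  have := SC _ S0; congr S; apply/seteqP; split => z //= _.
  by split.
by move: S0; congr S; apply/seteqP; split.
Qed.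

Lemma sigma_or {P Q} : S P -> S Q -> S (fun z => P z \/ Q z).
Proof.
move=> SP SQ.
have : S (fun z => exists b : bool, (if b then P else Q) z).
  by apply: sigma_exists; case.
congr S; apply/funext => z; apply/propext; split; first by case; case; [left|right].
by case; [exists true | exists false].
Qed.

Lemma sigma_and {P Q} : S P -> S Q -> S (fun z => P z /\ Q z).
Proof.
move=> SP SQ; have : S (fun z => forall b : bool, (if b then P else Q) z).
  by apply: sigma_forall; case.
congr S; apply/funext => z; apply/propext; split=> [h | [p q] []//].
by split; [exact: (h true) | exact: (h false)].
Qed.

Lemma sigma_imply {P Q} : S P -> S Q -> S (fun z => P z -> Q z).
Proof.
move=> SP SQ; have := sigma_or (sigma_not SP) SQ.
congr S; apply/funext => z; apply/propext; split; first by case=> [nP /nP|].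
by move=> PQ; case: (pselect (P z)) => [/PQ|]; [right|left].
Qed.

Lemma sigma_iff {P Q} : S P -> S Q -> S (fun z => P z <-> Q z).
Proof. by move=> SP SQ; apply: sigma_and; apply: sigma_imply. Qed.

Definition sigma_fun {C : Type} (f : Z -> C) := forall c, S (fun z => f z = c).

(** Splitting over the countably many values of [f] reduces to a fixed index; variable positions
    such as marker times are handled this way. *)
Lemma sigma_subst {C : countType} {f : Z -> C} {Q : C -> Z -> Prop} :
  sigma_fun f -> (forall c, S (Q c)) -> S (fun z => Q (f z) z).
Proof.
move=> Sf SQ; have := sigma_exists (fun c => sigma_and (Sf c) (SQ c)).
congr S; apply/funext => z; apply/propext; split; first by case=> c [->].
by exists (f z).
Qed.

Lemma sigma_fun_subst {C : countType} {D : Type} {f : Z -> C} {h : C -> Z -> D} :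
  sigma_fun f -> (forall c, sigma_fun (h c)) -> sigma_fun (fun z => h (f z) z).
Proof.
by move=> Sf Sh d; apply: (sigma_subst (Q := fun c z => h c z = d)) => // c; apply: Sh.
Qed.

Lemma sigma_fun_pred {C : countType} {f : Z -> C} (Q : C -> Prop) :
  sigma_fun f -> S (fun z => Q (f z)).
Proof.
by move=> Sf; apply: (sigma_subst (Q := fun c _ => Q c)) => // c; apply: sigma_const.
Qed.

Lemma sigma_fun_comp {C : countType} {D : Type} {f : Z -> C} (h : C -> D) :
  sigma_fun f -> sigma_fun (fun z => h (f z)).
Proof. by move=> Sf d; apply: (sigma_fun_pred (fun c => h c = d)). Qed.

Lemma sigma_fun2 {C D : countType} {E : Type} {f : Z -> C} {g : Z -> D}
    (h : C -> D -> E) :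
  sigma_fun f -> sigma_fun g -> sigma_fun (fun z => h (f z) (g z)).
Proof.
move=> Sf Sg; apply: (sigma_fun_subst (h := fun c z => h c (g z))) => // c.
exact: sigma_fun_comp.
Qed.

Lemma sigma_pred2 {C D : countType} {f : Z -> C} {g : Z -> D} (h : C -> D -> Prop) :
  sigma_fun f -> sigma_fun g -> S (fun z => h (f z) (g z)).
Proof.
move=> Sf Sg; apply: (sigma_subst (Q := fun c z => h c (g z))) => // c.
exact: sigma_fun_pred.
Qed.

End SigmaAlgebraPredicates.

(** * Least natural numbers and their measurability *)

Section Least.
Implicit Types A : nat -> Prop.

(* The default value [0] is returned when [A] is empty. *)
Definition least A : nat :=
  if pselect (exists n, `[< A n >]) is left exA then ex_minn exA else 0.

Lemma leastP {A} : (exists n, A n) -> A (least A).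
Proof.
move=> [n An]; rewrite /least; case: pselect => [exA|noA]; last by case: noA; exists n; apply/asboolP.
by case: ex_minnP => m /asboolP.
Qed.

Lemma least_le {A n} : A n -> least A <= n.
Proof.
move=> An; rewrite /least; case: pselect => [exA|noA]; last by case: noA; exists n; apply/asboolP.
by case: ex_minnP => m _; apply; apply/asboolP.
Qed.

Lemma least_unique {A n} : A n -> (forall m, A m -> n <= m) -> least A = n.
Proof.
move=> An minn; apply/eqP; rewrite eqn_leq least_le // minn //.
by apply: leastP; exists n.
Qed.

Lemma sigma_least {Z : Type} {S : set (set Z)} (salgS : sigma_algebra setT S)
    {A : Z -> nat -> Prop} :
  (forall n, S (fun z => A z n)) -> @sigma_fun Z S nat (fun z => least (A z)).
Proof.
move=> SA n.
have : S (fun z => (A z n /\ forall m, A z m -> n <= m) \/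
                   (n = 0 /\ forall m, ~ A z m)).
  apply: sigma_or => //; apply: sigma_and => //.
  - apply: sigma_forall => // m; apply: sigma_imply => //; exact: sigma_const.
  - exact: sigma_const.
  - by apply: sigma_forall => // m; apply: sigma_not.
congr S; apply/funext => z; apply/propext; split.
  case=> [[An minn]|[-> noA]]; first exact: least_unique.
  by rewrite /least; case: pselect => // exA; case: exA (exA) => m /asboolP Am; case: (noA m).
case: (pselect (exists m, A z m)) => [exA <-|noA <-].
  by left; split; [exact: leastP | move=> m; exact: least_le].
right; split=> [|m Am]; last by apply: noA; exists m.
by rewrite /least; case: pselect => // exA; case: exA (exA) => m /asboolP Am; case: noA; exists m.
Qed.

End Least.

(** * From labelled increasing relations to finite classes *)

Section BoundedIndices.
(* [K k] labels the [F k]-classes inside an [F k.+1]-class. *)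
Context {X : Type} (F : nat -> X -> X -> Prop) (K : nat -> X -> nat).
Hypothesis F_equiv : forall k, is_equivalence X (F k).
Hypothesis F0 : forall x y, F 0 x y -> x = y.
Hypothesis F_succ : forall k x y, F k x y -> F k.+1 x y.
Hypothesis K_invariant : forall k x y, F k x y -> K k x = K k y.
Hypothesis K_separates : forall k x y, F k.+1 x y -> K k x = K k y -> F k x y.

(** Labels are bounded only below the witnessing level [m]; the choice [m = 0] gives reflexivity
    however large the labels of [x] are. *)
Definition bounded_index_rel n x y :=
  exists m, m <= n /\ F m x y /\ forall i, i < m -> K i x <= n /\ K i y <= n.

Let F_le {k l x y} : k <= l -> F k x y -> F l x y.
Proof.
move=> /subnK <-; elim: (l - k) => //= d IH /IH; rewrite addSn; exact: F_succ.
Qed.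

(** For transitivity the larger of the two witnessing levels works: from the smaller level on, the
    two points related there share their labels, so the bound on one passes to the other. *)
Lemma bounded_index_equiv n : is_equivalence X (bounded_index_rel n).
Proof.
split; first by move=> x; exists 0; split=> //; split=> //; case: (F_equiv 0).
split.
  move=> x y [m [mn [Fm Km]]]; exists m; split=> //; split.
    by case: (F_equiv m) => _ [sym _]; apply: sym.
  by move=> i /Km [].
have half x y z m p : m <= p -> p <= n -> F m x y -> F p y z ->
    (forall i, i < m -> K i x <= n /\ K i y <= n) ->
    (forall i, i < p -> K i y <= n /\ K i z <= n) ->
    F p x z /\ forall i, i < p -> K i x <= n /\ K i z <= n.
  move=> mp pn Fxy Fyz Kxy Kyz; split.
    by case: (F_equiv p) => _ [_ tr]; apply: tr Fyz; apply: F_le Fxy.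
  move=> i ip; case: (ltnP i m) => im.
    by split; [case: (Kxy _ im) | case: (Kyz _ ip)].
  by rewrite (K_invariant _ _ _ (F_le im Fxy)); exact: Kyz.
move=> x y z [m [mn [Fxy Kxy]]] [p [pn [Fyz Kyz]]].
case: (leqP m p) => [mp|/ltnW pm].
  by exists p; split=> //; exact: half mp pn Fxy Fyz Kxy Kyz.
exists m; split=> //.
have sym k u v : F k u v -> F k v u by case: (F_equiv k) => _ [+ _]; apply.
case: (half z y x p m pm mn (sym _ _ _ Fyz) (sym _ _ _ Fxy)).
- by move=> i /Kyz [].
- by move=> i /Kxy [].
- by move=> Fzx Kzx; split; [exact: sym | move=> i /Kzx []].
Qed.

(** Inside an [F m.+1]-class each label value selects at most one [F m]-class, so induction from the
    singletons at level 0 leaves finitely many points. *)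
Lemma bounded_index_finite n x : finite_set [set y | bounded_index_rel n x y].
Proof.
have fin m : forall x, finite_set [set y | F m x y /\ forall i, i < m -> K i y <= n].
  elim: m => [|m IH] {}x.
    by apply: sub_finite_set (finite_set1 x) => y /= [/F0 ->].
  pose C c := [set y | F m.+1 x y /\ K m y = c /\ forall i, i < m -> K i y <= n].
  have finC c : finite_set (C c).
    case: (pselect (exists y, C c y)) => [[y0 [Fy0 [Ky0 _]]]|nC].
      apply: sub_finite_set (IH y0) => y [Fy [Ky Kyn]]; split=> //.
      apply: K_separates; last by rewrite Ky Ky0.
      by case: (F_equiv m.+1) => _ [sym tr]; apply: tr Fy; apply: sym.
    apply: sub_finite_set (finite_set0 X) => y Cy; apply: nC; by exists y.
  apply: sub_finite_set (bigcup_finite (finite_II n.+1) (fun c _ => finC c)).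
  move=> y [Fy Ky]; exists (K m y); first by rewrite /= ltnS; exact: Ky.
  by split=> //; split=> // i im; apply: Ky; apply: ltnW.
apply: sub_finite_set (bigcup_finite (finite_II n.+1) (fun m _ => fin m x)).
move=> y [m [mn [Fxy Kxy]]]; by exists m => //; split=> // i /Kxy [].
Qed.

Lemma bounded_index_succ n x y : bounded_index_rel n x y -> bounded_index_rel n.+1 x y.
Proof.
move=> [m [mn [Fxy Kxy]]]; exists m; split; first exact: leqW.
by split=> // i /Kxy [? ?]; split; apply: leqW.
Qed.

Lemma bounded_index_union x y :
  (exists k, F k x y) <-> exists n, bounded_index_rel n x y.
Proof.
split=> [[k Fk]|[n [m [_ [Fm _]]]]]; last by exists m.
(* The sum dominates every label of [x] and [y] below level [k]. *)
exists (k + \sum_(i < k) (K i x + K i y)), k; split; first exact: leq_addr.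
split=> // i ik; have : K i x + K i y <= \sum_(i < k) (K i x + K i y).
  by rewrite (bigD1 (Ordinal ik)) //= leq_addr.
move=> le; split; apply: leq_trans (leq_addl _ _); apply: leq_trans le.
  exact: leq_addr.
exact: leq_addl.
Qed.

End BoundedIndices.

(** * Segments and tails of sequences up to the group action *)

Section TailOrbits.
Context {G : countType} {mul : G -> G -> G} {one : G} {inv : G -> G}.
Context {V : countType} {act : G -> V -> V}.
Hypothesis groupG : is_group G mul one inv.
Hypothesis actionG : is_action G V mul one act.
Implicit Types (x y : nat -> V) (s : seq V).

Let act1 v : act one v = v. Proof. by case: actionG. Qed.

Let actM g h v : act (mul g h) v = act g (act h v). Proof. by case: actionG. Qed.

Let actK g : cancel (act g) (act (inv g)).
Proof. by move=> v; rewrite -actM; case: groupG => _ [_ [_ [-> _]]]. Qed.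

Definition tail_equiv x t y u := exists g, forall i, act g (x (t + i)) = y (u + i).

Lemma tail_equiv_refl x t : tail_equiv x t x t.
Proof. by exists one. Qed.

Lemma tail_equiv_sym {x t y u} : tail_equiv x t y u -> tail_equiv y u x t.
Proof. by case=> g gxy; exists (inv g) => i; rewrite -gxy actK. Qed.

Lemma tail_equiv_trans {x t y u z v} :
  tail_equiv x t y u -> tail_equiv y u z v -> tail_equiv x t z v.
Proof. by case=> g gxy [h hyz]; exists (mul h g) => i; rewrite actM gxy hyz. Qed.

Lemma tail_equiv_shift {x t y u} d :
  tail_equiv x t y u -> tail_equiv x (t + d) y (u + d).
Proof. by case=> g gxy; exists g => i; rewrite -!addnA. Qed.

Definition segment x t n : seq V := mkseq (fun i => x (t + i)) n.

Definition seg_equiv s s' := exists g, map (act g) s = s'.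

Lemma map_segmentP g x t n y u m :
  map (act g) (segment x t n) = segment y u m <->
  n = m /\ forall i, i < n -> act g (x (t + i)) = y (u + i).
Proof.
rewrite -map_comp; split=> [eq_seg|[<- eq_i]]; last first.
  by apply/eq_in_map => i; rewrite mem_iota => /eq_i.
have nm : n = m by have := congr1 size eq_seg; rewrite size_map size_iota size_mkseq.
split=> // i ltin; have := congr1 (fun s => nth (y 0) s i) eq_seg.
by rewrite (nth_map 0) ?size_iota // nth_iota // nth_mkseq -?nm.
Qed.

Lemma seg_equiv_sym {s s'} : seg_equiv s s' -> seg_equiv s' s.
Proof. by case=> g <-; exists (inv g); rewrite (mapK (actK g)). Qed.

Lemma seg_equiv_trans {s s' s''} : seg_equiv s s' -> seg_equiv s' s'' -> seg_equiv s s''.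
Proof.
case=> g <- [h <-]; exists (mul h g).
by rewrite -map_comp; apply: eq_map => v; rewrite /= actM.
Qed.

Lemma tail_equiv_segment {x t y u} n :
  tail_equiv x t y u -> seg_equiv (segment x t n) (segment y u n).
Proof. by case=> g gxy; exists g; apply/map_segmentP. Qed.

(** The least code met in an orbit is a canonical name for it. Since [s] itself has a code, the
    default 0 of [least] never intervenes. *)
Definition seg_code s : nat :=
  least (fun n => exists s', unpickle n = Some s' /\ seg_equiv s s').

Lemma seg_codeP s s' : seg_code s = seg_code s' <-> seg_equiv s s'.
Proof.
split=> [eq_code|ss']; last first.
  congr least; apply/funext => n; apply/propext.
  split=> -[r [nr sr]]; exists r; split=> //.
    exact: seg_equiv_trans (seg_equiv_sym ss') sr.
  exact: seg_equiv_trans ss' sr.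
have codeP r : exists r', unpickle (seg_code r) = Some r' /\ seg_equiv r r'.
  apply: (leastP (A := fun n => exists r', unpickle n = Some r' /\ seg_equiv r r')).
  exists (pickle r), r; rewrite pickleK; split=> //; exists one.
  by rewrite -[RHS]map_id; apply: eq_map.
have [r [er sr]] := codeP s; have [r' [er' s'r']] := codeP s'.
move: er; rewrite eq_code er' => -[eqr]; move: s'r'; rewrite eqr => /seg_equiv_sym.
exact: seg_equiv_trans.
Qed.

(** Here [n] counts vertices, whereas [stab_segment] includes the vertex of index [n]. *)
Definition stab_bound x t n := forall g,
  (forall i, i < n -> act g (x (t + i)) = x (t + i)) ->
  forall i, act g (x (t + i)) = x (t + i).

Definition stab_finite x := forall t, exists n, stab_bound x t n.

Definition stab_length x t := least (stab_bound x t).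

(** Conjugation by the aligning element carries the stabilisers of segments and tails of one
    sequence to those of the other. *)
Lemma tail_equiv_stab_length {x t y u} :
  tail_equiv x t y u -> stab_length x t = stab_length y u.
Proof.
have half x' t' y' u' n : tail_equiv x' t' y' u' -> stab_bound x' t' n -> stab_bound y' u' n.
  case=> g gxy bx h hy i; rewrite -gxy.
  have := bx (mul (inv g) (mul h g)) _ i; rewrite !actM => fix_i.
  rewrite -[in RHS]fix_i => [|j /hy]; last by rewrite !actM gxy => ->; rewrite -gxy actK.
  set w := act h _; rewrite -actM.
  by case: groupG => _ [_ [_ [_ ->]]]; rewrite act1.
move=> xy; congr least; apply/funext => n; apply/propext.
by split; apply: half => //; apply: tail_equiv_sym.
Qed.

(** * Recurring prefixes and the choice of markers *)

Definition infinitely_often (A : nat -> Prop) := forall m, exists i, m <= i /\ A i.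

(** This makes each greedy choice of a bit depend only on the orbit of a tail. *)
Lemma infinitely_often_shift (A B : nat -> Prop) t u :
  (forall i, A (t + i) <-> B (u + i)) -> infinitely_often A <-> infinitely_often B.
Proof.
have half A' B' t' u' : (forall i, A' (t' + i) <-> B' (u' + i)) ->
    infinitely_often A' -> infinitely_often B'.
  move=> AB ioA m; have [i [le_i Ai]] := ioA (t' + m).
  have ti : t' <= i by apply: leq_trans le_i; apply: leq_addr.
  exists (u' + (i - t')); split; last by apply/AB; rewrite subnKC.
  by apply: leq_trans (leq_addl _ _); rewrite leq_subRL.
by move=> AB; split; apply: half => // i; split=> /AB.
Qed.

(** This is bit number [k] at position [i]. A number that decodes to no sequence gives a bit that is
    always false. *)
Definition prefix_class k x i :=
  exists s, unpickle k = Some s /\ seg_equiv s (segment x i (size s)).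

Lemma tail_equiv_prefix_class {x t y u} k :
  tail_equiv x t y u -> prefix_class k x t <-> prefix_class k y u.
Proof.
move=> xy; split=> -[s [ks sx]]; exists s; split=> //; apply: seg_equiv_trans sx _.
  exact: tail_equiv_segment.
exact/tail_equiv_segment/tail_equiv_sym.
Qed.

(* The positions whose first [k] prefix bits form the greedy word: each bit is set
   exactly when setting it keeps infinitely many positions. *)
Fixpoint frequent k x i : Prop :=
  if k is k'.+1 then
    frequent k' x i /\
    (prefix_class k' x i <->
     infinitely_often (fun j => frequent k' x j /\ prefix_class k' x j))
  else True.

(** If bit [k] holds infinitely often among the current positions, those are kept; otherwise it
    fails from some position on, and all later current positions are kept. *)
Lemma frequent_infinitely_often k x : infinitely_often (frequent k x).
Proof.
elim: k => [m|k IH m]; first by exists m.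
set ioP := infinitely_often (fun j => frequent k x j /\ prefix_class k x j).
case: (pselect ioP) => [io|nio].
  by have [i [mi [Fi Pi]]] := io m; exists i.
have [p np] : exists p, forall i, p <= i -> ~ (frequent k x i /\ prefix_class k x i).
  apply: contrapT => nex; apply: nio => p; apply: contrapT => nexi.
  by apply: nex; exists p => i pi FPi; apply: nexi; exists i.
have [i [+ Fi]] := IH (maxn m p); rewrite geq_max => /andP[mi /np nFPi].
by exists i; split=> //; split=> //; split=> // Pi; case: nFPi.
Qed.

Lemma tail_equiv_frequent {x t y u} k :
  tail_equiv x t y u -> frequent k x t <-> frequent k y u.
Proof.
elim: k t u => //= k IH t u xy.
have ioE : infinitely_often (fun j => frequent k x j /\ prefix_class k x j) <->
           infinitely_often (fun j => frequent k y j /\ prefix_class k y j).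
  apply: (infinitely_often_shift _ _ t u) => i.
  have xyi := tail_equiv_shift i xy.
  by have := IH _ _ xyi; have := tail_equiv_prefix_class k xyi; tauto.
by have := IH _ _ xy; have := tail_equiv_prefix_class k xy; tauto.
Qed.

Definition always_frequent x i := forall k, frequent k x i.

Lemma tail_equiv_always_frequent {x t y u} :
  tail_equiv x t y u -> always_frequent x t <-> always_frequent y u.
Proof.
by move=> xy; split=> af k; have := af k; have := tail_equiv_frequent k xy; tauto.
Qed.

(* Such positions have the same prefix bits, hence the same orbits of finite initial
   segments; the stabiliser condition upgrades this to the infinite tails. *)
Lemma always_frequent_unique {x t y u i j} :
  stab_finite x -> tail_equiv x t y u ->
  always_frequent x i -> always_frequent y j -> tail_equiv x i y j.
Proof.
move=> sfx xy afx afy.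
have prefix_ij k : prefix_class k x i <-> prefix_class k y j.
  have [_ Px] := afx k.+1; have [_ Py] := afy k.+1.
  have ioE : infinitely_often (fun j => frequent k x j /\ prefix_class k x j) <->
             infinitely_often (fun j => frequent k y j /\ prefix_class k y j).
    apply: (infinitely_often_shift _ _ t u) => l.
    have xyl := tail_equiv_shift l xy.
    by have := tail_equiv_frequent k xyl; have := tail_equiv_prefix_class k xyl; tauto.
  by tauto.
have seg_ij n : seg_equiv (segment x i n) (segment y j n).
  (* The bit to compare is the one indexed by the code of this very segment. *)
  have : prefix_class (pickle (segment x i n)) x i.
    exists (segment x i n); rewrite pickleK size_mkseq; split=> //.
    exact/tail_equiv_segment/tail_equiv_refl.
  by move/prefix_ij => [s []]; rewrite pickleK => -[<-]; rewrite size_mkseq.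
have [n bn] := sfx i; have [g /map_segmentP [_ gxy]] := seg_ij n.
(* The length [n + l.+1] lets [h] agree with [g] on the first [n] vertices and still reach vertex
   [l]; then [mul (inv h) g] fixes those [n] vertices, hence the whole tail. *)
exists g => l; have [h /map_segmentP [_ hxy]] := seg_ij (n + l.+1).
have hxyl : act h (x (i + l)) = y (j + l) by apply: hxy; rewrite addnS ltnS leq_addl.
have := bn (mul (inv h) g) _ l; rewrite actM => fixl.
rewrite -hxyl -[in RHS]fixl => [|m mn].
  by set w := act g _; rewrite -actM; case: groupG => _ [_ [_ [_ ->]]]; rewrite act1.
by rewrite actM gxy // -hxy ?actK //; apply: ltn_addr.
Qed.

(* When the always frequent positions are cofinal they represent a single orbit of
   rays, which serves as a constant marker; otherwise removing them makes the
   markers vanish. *)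
Definition marker k x i :=
  (infinitely_often (always_frequent x) /\ always_frequent x i) \/
  (~ infinitely_often (always_frequent x) /\ frequent k x i /\ ~ always_frequent x i).

Lemma marker_infinitely_often k x : infinitely_often (marker k x).
Proof.
move=> m; case: (pselect (infinitely_often (always_frequent x))) => [io|nio].
  by have [i [mi afi]] := io m; exists i; split=> //; left.
have [p np] : exists p, forall i, p <= i -> ~ always_frequent x i.
  apply: contrapT => nex; apply: nio => p; apply: contrapT => nexi.
  by apply: nex; exists p => i pi afi; apply: nexi; exists i.
have [i [+ Fi]] := frequent_infinitely_often k x (maxn m p).
by rewrite geq_max => /andP[mi /np naf]; exists i; split=> //; right.
Qed.

Lemma marker_pred k x i : marker k.+1 x i -> marker k x i.
Proof. by case=> [|[nio [[Fi _] naf]]]; [left | right]. Qed.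

Lemma marker_le {k l} x i : k <= l -> marker l x i -> marker k x i.
Proof. by move=> /subnK <-; elim: (l - k) => //= d IH; rewrite addSn => /marker_pred. Qed.

Lemma tail_equiv_marker {x t y u} k :
  tail_equiv x t y u -> marker k x t <-> marker k y u.
Proof.
move=> xy; rewrite /marker.
have ioE : infinitely_often (always_frequent x) <-> infinitely_often (always_frequent y).
  apply: (infinitely_often_shift _ _ t u) => i.
  exact/tail_equiv_always_frequent/tail_equiv_shift.
have := tail_equiv_always_frequent xy; have := tail_equiv_frequent k xy; tauto.
Qed.

(** * Marker times, the relations they define and their labels *)

Definition marker_time k x := least (marker k x).

Lemma marker_timeP k x : marker k x (marker_time k x).
Proof. by apply: leastP; have [i [_ Mi]] := marker_infinitely_often k x 0; exists i. Qed.

Lemma marker_time_succ k x : marker_time k x <= marker_time k.+1 x.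
Proof. exact/least_le/marker_pred/marker_timeP. Qed.

(** Tail equivalence matches the markers from [t] on with those from [u] on, so the first ones lie
    at equal distance. *)
Lemma marker_time_delay {x t y u} k : tail_equiv x t y u ->
  t <= marker_time k x -> u <= marker_time k y ->
  marker_time k x - t = marker_time k y - u.
Proof.
have half x' t' y' u' : tail_equiv x' t' y' u' -> t' <= marker_time k x' ->
    marker_time k y' - u' <= marker_time k x' - t'.
  move=> xy tx; rewrite leq_subLR; apply: least_le.
  apply/(tail_equiv_marker k (tail_equiv_shift (marker_time k x' - t') xy)).
  by rewrite subnKC //; exact: marker_timeP.
move=> xy tx uy; apply/eqP; rewrite eqn_leq !half //.
exact: tail_equiv_sym.
Qed.

Definition marker_rel k x y : Prop :=
  if k is k'.+1 then tail_equiv x (marker_time k' x) y (marker_time k' y) else x = y.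

(** The segment runs to the next marker and on for [stab_length] vertices, which under [stab_finite]
    have the same stabiliser as the tail there. Level 0 records the segment itself rather than its
    orbit, because its classes are single points. *)
Definition marker_index k x : nat :=
  if k is k'.+1 then
    seg_code (segment x (marker_time k' x)
      (marker_time k x - marker_time k' x + stab_length x (marker_time k x)))
  else pickle (segment x 0 (marker_time 0 x + stab_length x (marker_time 0 x))).

Lemma marker_rel_equiv k : is_equivalence (nat -> V) (marker_rel k).
Proof.
case: k => [|k]; first by split=> //; split=> [x y ->|x y z -> ->].
split=> [x|]; first exact: tail_equiv_refl.
by split=> [x y|x y z]; [exact: tail_equiv_sym | exact: tail_equiv_trans].
Qed.

Lemma marker_rel_delay {k x y} : marker_rel k.+1 x y ->
  marker_time k.+1 x - marker_time k x = marker_time k.+1 y - marker_time k y.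
Proof. by move=> xy; apply: marker_time_delay xy _ _; apply: marker_time_succ. Qed.

Lemma marker_rel_succ k x y : marker_rel k x y -> marker_rel k.+1 x y.
Proof.
case: k => [->|k xy]; first exact: tail_equiv_refl.
have := tail_equiv_shift (marker_time k.+1 x - marker_time k x) xy.
by rewrite {2}(marker_rel_delay xy) !subnKC //; apply: marker_time_succ.
Qed.

Lemma marker_index_invariant k x y : marker_rel k x y -> marker_index k x = marker_index k y.
Proof.
case: k => [->//|k xy]; apply/seg_codeP; rewrite (marker_rel_delay xy).
by rewrite (tail_equiv_stab_length (marker_rel_succ _ _ _ xy)); apply: tail_equiv_segment.
Qed.

Lemma stab_lengthP x t : stab_finite x -> stab_bound x t (stab_length x t).
Proof. by move=> sfx; apply: leastP; apply: sfx. Qed.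

(** Let [g] align the tails at the next marker and [h] the recorded segments. They agree on the
    final [stab_length] vertices, so [mul (inv g) h] fixes these, hence the tail of [x], and [h]
    carries that tail just as [g] does. *)
Lemma marker_index_separates k x y : stab_finite x ->
  marker_rel k.+1 x y -> marker_index k x = marker_index k y -> marker_rel k x y.
Proof.
move=> sfx xy; have stabE := tail_equiv_stab_length xy; case: xy => g gxy.
have bx t := stab_lengthP x t sfx.
case: k gxy stabE => [|k] gxy stabE /=.
  move/(pcan_inj pickleK) => eq_seg.
  (* At level 0 the segments are equal, so the identity takes the role of [h]. *)
  have : map (act one) (segment x 0 (marker_time 0 x + stab_length x (marker_time 0 x))) =
         segment y 0 (marker_time 0 y + stab_length y (marker_time 0 y)).
    by rewrite -eq_seg -[RHS]map_id; apply: eq_map.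
  (* Equal total lengths and equal stabiliser lengths force equal marker times. *)
  move/map_segmentP; rewrite stabE => -[/addIn eqt eq_i].
  rewrite -eqt in gxy eq_i stabE; set t := marker_time 0 x in eq_i gxy stabE.
  have fixg : forall i, act g (x (t + i)) = x (t + i).
    apply: bx => i; rewrite stabE => ilt.
    by rewrite gxy -[RHS]act1 -[in RHS](add0n (t + i)) eq_i // ltn_add2l.
  apply/funext => i; case: (ltnP i t) => it.
    by rewrite -[LHS]act1 -[in LHS](add0n i) eq_i //; apply: ltn_addr.
  by rewrite -(subnKC it) -gxy fixg.
move/seg_codeP => [h /map_segmentP[]]; rewrite stabE => /addIn eqd hxy.
exists h => i.
set a := marker_time k x in eqd hxy *; set b := marker_time k y in eqd hxy *.
set a' := marker_time k.+1 x in eqd hxy gxy stabE.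
set b' := marker_time k.+1 y in eqd hxy gxy stabE.
have aa' : a <= a' by exact: marker_time_succ.
have bb' : b <= b' by exact: marker_time_succ.
(* Before the next marker the position lies in the recorded segment; from there on the stabiliser
   argument applies. *)
case: (ltnP i (a' - a)) => id; first by apply: hxy; apply: ltn_addr.
have -> : a + i = a' + (i - (a' - a)) by rewrite -[X in _ = X + _](subnKC aa') -addnA subnKC.
have -> : b + i = b' + (i - (a' - a)) by rewrite eqd -[X in _ = X + _](subnKC bb') -addnA subnKC // -eqd.
move: (i - _) => {id}i; have := bx a' (mul (inv g) h) _ i; rewrite actM => fixi.
rewrite -gxy -[in RHS]fixi => [|j].
  by set w := act h _; rewrite -actM; case: groupG => _ [_ [_ [_ ->]]]; rewrite act1.
rewrite stabE => jl; rewrite actM -[RHS](actK g) gxy; congr act.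
have := hxy (a' - a + j); rewrite ltn_add2l => /(_ jl).
by rewrite !addnA subnKC // eqd subnKC.
Qed.

Lemma marker_rel_union {x y} : stab_finite x ->
  (exists k, marker_rel k x y) <-> exists m n, tail_equiv x m y n.
Proof.
move=> sfx; split=> [[[->|k xy]]|[m [n xy]]].
- by exists 0, 0; apply: tail_equiv_refl.
- by exists (marker_time k x), (marker_time k y).
(* In the first case all markers are always frequent positions, whose tails are equivalent, so level
   1 suffices. *)
case: (pselect (infinitely_often (always_frequent x))) => [iox|niox].
  have ioy : infinitely_often (always_frequent y).
    apply/(infinitely_often_shift _ (always_frequent x) n m) => // i.
    exact/tail_equiv_always_frequent/tail_equiv_shift/tail_equiv_sym.
  exists 1; apply: (always_frequent_unique sfx xy).
    by case: (marker_timeP 0 x) => -[].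
  by case: (marker_timeP 0 y) => -[].
have nioy : ~ infinitely_often (always_frequent y).
  move=> ioy; apply: niox; apply/(infinitely_often_shift _ (always_frequent y) m n) => // i.
  exact/tail_equiv_always_frequent/tail_equiv_shift.
(* A position marked at every level would be always frequent, which markers exclude in this case. So
   each position below [p] drops out at some level, and a maximum of these levels clears them
   all. *)
have vanish z p : ~ infinitely_often (always_frequent z) ->
    exists k, forall l, k <= l -> p <= marker_time l z.
  move=> nioz.
  have [k nM] : exists k, forall i, i < p -> ~ marker k z i.
    elim: p => [|p [k nM]]; first by exists 0.
    have [k' nM'] : exists k', ~ marker k' z p.
      apply: contrapT => nex.
      have allM k' : marker k' z p by apply: contrapT => nM'; apply: nex; exists k'.
      case: (allM 0) => [[]//|[_ [_ naf]]]; apply: naf => k'.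
      by case: (allM k') => [[]//|[_ []]].
    exists (maxn k k') => i; rewrite ltnS leq_eqVlt => /predU1P[->|ip] Mi.
      by apply: nM'; apply: marker_le Mi; apply: leq_maxr.
    by apply: (nM i ip); apply: marker_le Mi; apply: leq_maxl.
  exists k => l kl; rewrite leqNgt; apply/negP => lt_p.
  by apply: (nM _ lt_p); apply: marker_le kl _; apply: marker_timeP.
have [k kx] := vanish x m niox; have [l ly] := vanish y n nioy.
(* At level [q] both marker times have passed the aligned positions [m] and [n], so they occur after
   equal delays. *)
pose q := maxn k l; exists q.+1.
have mq : m <= marker_time q x by apply/kx/leq_maxl.
have nq : n <= marker_time q y by apply/ly/leq_maxr.
have := tail_equiv_shift (marker_time q x - m) xy.
by rewrite {2}(marker_time_delay q xy mq nq) !subnKC.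
Qed.

(** * Borel dependence of markers and labels on the ray *)

Section Measurability.
Context {Z : Type} {S : set (set Z)} (salgS : sigma_algebra setT S).

Let sfun {C : Type} (f : Z -> C) := @sigma_fun Z S C f.

Lemma sigma_segment {a : Z -> nat -> V} t n :
  (forall i, sfun (a^~ i)) -> sfun (fun z => segment (a z) t n).
Proof.
rewrite /segment /mkseq => Sa; elim: (iota 0 n) => [|i r IH] /=.
  by move=> s; apply: sigma_const.
exact: (sigma_fun2 salgS cons (Sa (t + i)) IH).
Qed.

Lemma sigma_infinitely_often {A : Z -> nat -> Prop} :
  (forall i, S (A^~ i)) -> S (fun z => infinitely_often (A z)).
Proof.
move=> SA; apply: sigma_forall => // m; apply: sigma_exists => // i.
by apply: sigma_and => //; apply: sigma_const.
Qed.

Context {a : Z -> nat -> V} (Sa : forall i, sfun (a^~ i)).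

Lemma sigma_prefix_class k i : S (fun z => prefix_class k (a z) i).
Proof.
apply: sigma_exists => // s; apply: sigma_and => //; first exact: sigma_const.
exact: (sigma_fun_pred salgS (seg_equiv s) (sigma_segment i (size s) Sa)).
Qed.

Lemma sigma_frequent k i : S (fun z => frequent k (a z) i).
Proof.
elim: k i => [|k IH] i /=; first exact: sigma_const.
apply: sigma_and => //; apply: sigma_iff => //; first exact: sigma_prefix_class.
apply: sigma_infinitely_often => j.
by apply: sigma_and => //; apply: sigma_prefix_class.
Qed.

Lemma sigma_marker k i : S (fun z => marker k (a z) i).
Proof.
have Saf j : S (fun z => always_frequent (a z) j).
  by apply: sigma_forall => // l; apply: sigma_frequent.
have Sio : S (fun z => infinitely_often (always_frequent (a z))).
  exact: sigma_infinitely_often.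
apply: sigma_or => //; apply: sigma_and => //; first exact: sigma_not.
by apply: sigma_and => //; [exact: sigma_frequent | exact: sigma_not].
Qed.

Lemma sigma_marker_time k : sfun (fun z => marker_time k (a z)).
Proof. by apply: sigma_least => // n; apply: sigma_marker. Qed.

Lemma sigma_stab_length t : sfun (fun z => stab_length (a z) t).
Proof.
apply: sigma_least => // n; apply: sigma_forall => // g.
have Sfix i : S (fun z => act g (a z (t + i)) = a z (t + i)).
  exact: (sigma_fun_pred salgS (fun v => act g v = v) (Sa (t + i))).
apply: sigma_imply => //; apply: sigma_forall => // i.
by apply: sigma_imply => //; apply: sigma_const.
Qed.

Lemma sigma_marker_index k : sfun (fun z => marker_index k (a z)).
Proof.
have Slen j : sfun (fun z => stab_length (a z) (marker_time j (a z))).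
  exact: (sigma_fun_subst salgS (h := fun t z => stab_length (a z) t)
    (sigma_marker_time j) sigma_stab_length).
have Sseg t (n : Z -> nat) : sfun n -> sfun (fun z => segment (a z) t (n z)).
  move=> Sn; apply: (sigma_fun_subst salgS (h := fun n z => segment (a z) t n) Sn) => l.
  exact: sigma_segment.
case: k => [|k] /=.
  apply: (sigma_fun_comp salgS pickle); apply: Sseg.
  exact: (sigma_fun2 salgS addn (sigma_marker_time 0) (Slen 0)).
apply: (sigma_fun_comp salgS seg_code).
apply: (sigma_fun_subst salgS
  (h := fun t z => segment (a z) t (marker_time k.+1 (a z) - marker_time k (a z) +
                                    stab_length (a z) (marker_time k.+1 (a z))))
  (sigma_marker_time k)) => t.
apply: Sseg; apply: (sigma_fun2 salgS addn _ (Slen k.+1)).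
exact: (sigma_fun2 salgS subn (sigma_marker_time k.+1) (sigma_marker_time k)).
Qed.

End Measurability.

Lemma sigma_marker_rel {Z : Type} {S : set (set Z)} (salgS : sigma_algebra setT S)
    {a b : Z -> nat -> V} k :
  (forall i, @sigma_fun Z S V (a^~ i)) -> (forall i, @sigma_fun Z S V (b^~ i)) ->
  S (fun z => marker_rel k (a z) (b z)).
Proof.
move=> Sa Sb; case: k => [|k] /=.
  have : S (fun z => forall i, a z i = b z i).
    apply: sigma_forall => // i; exact: (sigma_pred2 salgS eq (Sa i) (Sb i)).
  by congr S; apply/funext => z; apply/propext; split=> [/funext|-> ].
apply: sigma_exists => // g; apply: sigma_forall => // i.
have Stail c : (forall i, @sigma_fun Z S V (c^~ i)) ->
    @sigma_fun Z S V (fun z => c z (marker_time k (c z) + i)).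
  move=> Sc; apply: (sigma_fun_subst salgS (h := fun t z => c z (t + i))) => //.
  exact: sigma_marker_time.
exact: (sigma_pred2 salgS (fun v w => act g v = w) (Stail a Sa) (Stail b Sb)).
Qed.

End TailOrbits.

(** * Tail equality and boundary classes *)

Section TailEquality.
Context {V : countType} {adj : rel V}.
Implicit Types u v w : nat -> V.

Lemma tail_eq_sym {v w} : tail_eq V v w -> tail_eq V w v.
Proof. by case=> m [n vw]; exists n, m. Qed.

Lemma tail_eq_trans {u v w} : tail_eq V u v -> tail_eq V v w -> tail_eq V u w.
Proof.
case=> m [n uv] [p [q vw]]; exists (m + p), (q + n) => k.
by rewrite -addnA uv addnCA vw addnA.
Qed.

Lemma tclass_eq {v w} : tail_eq V v w -> tclass V adj v = tclass V adj w.
Proof.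
move=> vw; apply/seteqP; split=> u [gu] uu; split=> //.
  exact: tail_eq_trans (tail_eq_sym vw) uu.
exact: tail_eq_trans vw uu.
Qed.

Lemma tclass_tail_eq {v w} : geodesic V adj w -> tclass V adj v = tclass V adj w -> tail_eq V v w.
Proof.
move=> gw eq_class; have : tclass V adj w w by split=> //; exists 0, 0.
by rewrite -eq_class => -[].
Qed.

End TailEquality.

(** * Geodesics in a tree *)

Section TreeGeodesics.
Context {V : countType} {adj : rel V} (treeV : is_tree V adj).
Implicit Types (v w : nat -> V) (s : seq V).

Let adjC x y : adj x y = adj y x. Proof. by case: treeV. Qed.

(** Where two simple paths diverge at [x], following one and returning along the other joins [a] to
    [b] while avoiding [x]; shortened and closed up through [x], this is a cycle. *)
Lemma uniq_path_unique x (p q : seq V) : path adj x p -> path adj x q ->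
  uniq (x :: p) -> uniq (x :: q) -> last x p = last x q -> p = q.
Proof.
elim: p x q => [|a p IH] x [|b q] //.
- by move=> _ _ _ /= /andP[+ _] eqx; rewrite [in x \in _]eqx mem_last.
- by move=> _ _ /= /andP[+ _] _ eqx; rewrite -[in x \in _]eqx mem_last.
move=> /= /andP[xa pa] /andP[xb qb] /andP[xp up] /andP[xq uq] eq_last.
case: (eqVneq a b) => [eab|neab].
  by move: qb xq uq eq_last; rewrite -eab => qb xq uq eq_last; rewrite (IH a q).
pose c := p ++ rev (belast b q).
have path_c : path adj a c.
  rewrite cat_path pa eq_last rev_path.
  by rewrite (eq_path (e' := adj)) // => y z; rewrite adjC.
have last_c : last a c = b.
  rewrite last_cat eq_last; case: (q) => //= d q'.
  by rewrite rev_cons last_rcons.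
have xc : x \notin a :: c.
  move: xp; rewrite !inE !negb_or => /andP[-> xp].
  rewrite mem_cat negb_or xp mem_rev /=.
  by apply: contra xq => /mem_belast.
move: last_c; case: (shortenP path_c) => c' path_c' uniq_c' sub_c' last_c'.
case: treeV => _ [_ [_ /(_ x (a :: c')) nocycle]]; exfalso; apply/negP: xb.
rewrite -last_c' adjC; apply: nocycle => /=; last by rewrite xa.
  by case: (c') last_c' => //= eab; rewrite eab eqxx in neab.
rewrite [X in _ && X]uniq_c' andbT; move: xc; rewrite !inE !negb_or => /andP[-> xc] /=.
by apply: contra xc => /sub_c'.
Qed.

Lemma geodesic_prefix v n : geodesic V adj v ->
  let s := mkseq (fun i => v i.+1) n in
  [/\ path adj (v 0) s, uniq (v 0 :: s) & last (v 0) s = v n].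
Proof.
move=> [injv adjv] s.
have consE : v 0 :: s = mkseq v n.+1 by rewrite /s /mkseq /= (iotaDl 1 0) -map_comp.
split; last by rewrite (last_nth (v 0)) consE size_mkseq nth_mkseq.
  apply/(pathP (v 0)) => i; rewrite size_mkseq consE => ltin.
  by rewrite !nth_mkseq // ltnW.
by rewrite consE mkseq_uniq.
Qed.

(** Uniqueness of the path from the common start to [v m = w n] forces [m = n]; the sequences then
    agree before and after that vertex. *)
Lemma geodesic_unique v w : geodesic V adj v -> geodesic V adj w ->
  v 0 = w 0 -> tail_eq V v w -> v = w.
Proof.
move=> gv gw vw0 [m [n vw]].
have [pv uv lv] := geodesic_prefix v m gv; have [pw uw lw] := geodesic_prefix w n gw.
rewrite -vw0 in pw uw lw.
have eq_last : last (v 0) (mkseq (fun i => v i.+1) m) =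
               last (v 0) (mkseq (fun i => w i.+1) n).
  by rewrite lv lw; have := vw 0; rewrite !addn0.
have eq_pre := uniq_path_unique _ _ _ pv pw uv uw eq_last.
have mn : m = n by have := congr1 size eq_pre; rewrite !size_mkseq.
apply/funext => -[//|i]; case: (ltnP i m) => im.
  by have := congr1 (fun s => nth (v 0) s i) eq_pre; rewrite !nth_mkseq // -mn.
by rewrite -(subnKC (leqW im)) vw mn.
Qed.

(** The default value of [nth] is the ray, which takes over past the end of [s]. *)
Definition prepend s v i := nth (v (i - size s)) s i.

Lemma prepend_tail_eq s v m : tail_eq V (prepend s (fun i => v (m + i))) v.
Proof.
by exists (size s), m => k; rewrite /prepend nth_default ?addKn // leq_addr.
Qed.

(* A shortest path from [o] to the ray [v] meets [v] only at its endpoint. *)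
Lemma geodesic_from o v : geodesic V adj v ->
  exists s m, geodesic V adj (prepend s (fun i => v (m + i))) /\
              prepend s (fun i => v (m + i)) 0 = o.
Proof.
move=> [injv adjv].
pose reach n := `[< exists s m, [/\ size s = n, path adj o s & last o s = v m] >].
have exn : exists n, reach n.
  case: treeV => _ [_ [conn _]]; have [s [ps ls]] := conn o (v 0).
  by exists (size s); apply/asboolP; exists s, 0.
case: (ex_minnP exn) => n /asboolP[s0 [m [size_s0 path_s0 last_s0]]] minn.
have min_s s m' : path adj o s -> last o s = v m' -> n <= size s.
  by move=> ps ls; apply: minn; apply/asboolP; exists s, m'.
move: last_s0; case: (shortenP path_s0) => s path_s uniq_s sub_s last_s.
have size_s : size s = n.
  apply/eqP; rewrite eqn_leq (min_s s m) // andbT -size_s0.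
  by apply: uniq_leq_size => //; case/andP: uniq_s.
(* The endpoint of [s] is already [v m]; [belast] keeps it from occurring twice. *)
exists (belast o s), m; set r := prepend _ _.
have r_lt i : i < n -> r i = nth o (o :: s) i.
  move=> ltin; rewrite /r /prepend lastI nth_rcons size_belast size_s ltin.
  by apply: set_nth_default; rewrite size_belast size_s.
have r_ge i : n <= i -> r i = v (m + (i - n)).
  by move=> lein; rewrite /r /prepend nth_default size_belast size_s.
have r_n : nth o (o :: s) n = v m by rewrite -size_s -last_nth.
have r_le i : i <= n -> r i = nth o (o :: s) i.
  rewrite leq_eqVlt => /predU1P[->|/r_lt//].
  by rewrite r_ge // subnn addn0 r_n.
split; last by rewrite r_le.
(* A vertex of the path before its end that lay on [v] would give a shorter path to [v]. *)
have off i j : i < n -> n <= j -> r i <> r j.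
  move=> ltin lenj; rewrite r_lt // r_ge // => eq_ij.
  have := min_s (take i s) (m + (j - n)); rewrite size_take size_s ltin leqNgt ltin.
  move=> absurd; have //: false; apply: absurd; first exact: take_path.
  by rewrite -eq_ij (last_nth o) size_take size_s ltin -[o :: take i s]/(take i.+1 (o :: s)) nth_take.
split=> [i j|i].
  case: (ltnP i n) => ltin; case: (ltnP j n) => ltjn.
  - rewrite !r_lt // => /eqP; rewrite nth_uniq //= ?size_s ?ltnS 1?ltnW //.
    by move/eqP.
  - by move/(off _ _ ltin ltjn).
  - by move/esym/(off _ _ ltjn ltin).
  - rewrite !r_ge // => /injv /addnI eq_ij.
    by rewrite -(subnKC ltin) eq_ij subnKC.
case: (ltnP i n) => ltin.
  by rewrite r_lt // r_le //=; move/(pathP o): path_s; apply; rewrite size_s.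
by rewrite !r_ge ?leqW // subSn // addnS.
Qed.

(** * Rays from a base vertex and the Borel structure of the boundary *)

Context (o : V).

Lemma ray_exists (x : boundary V adj) : exists r : nat -> V,
  geodesic V adj r /\ r 0 = o /\ sval x = tclass V adj r.
Proof.
case: x => A /= [v [gv ->]]; have [s [m [gr r0]]] := geodesic_from o v gv.
exists (prepend s (fun i => v (m + i))); split=> //; split=> //.
exact/tclass_eq/tail_eq_sym/prepend_tail_eq.
Qed.

Definition ray (x : boundary V adj) : nat -> V := sval (cid (ray_exists x)).

Lemma ray_geodesic x : geodesic V adj (ray x).
Proof. by case: (svalP (cid (ray_exists x))). Qed.

Lemma ray0 x : ray x 0 = o.
Proof. by case: (svalP (cid (ray_exists x))) => _ []. Qed.

Lemma ray_tclass x : sval x = tclass V adj (ray x).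
Proof. by case: (svalP (cid (ray_exists x))) => _ []. Qed.

Lemma ray_inj : injective ray.
Proof. move=> x y eq_ray; have : sval x = sval y by rewrite !ray_tclass eq_ray.
by case: x y {eq_ray} => A pA [B pB]; apply: eq_exist. Qed.

(** Although [ray] comes from a choice, this identifies it with any ray from [o] built out of a
    representative, which is how its coordinates are shown to be Borel. *)
Lemma ray_unique x v w : sval x = tclass V adj w -> tail_eq V v w ->
  geodesic V adj v -> v 0 = o -> ray x = v.
Proof.
move=> xw vw gv v0; apply: geodesic_unique => //; [exact: ray_geodesic|by rewrite ray0|].
apply: tclass_tail_eq gv _; rewrite -ray_tclass xw; exact/tclass_eq/tail_eq_sym.
Qed.

Lemma borel_seq_sigma_algebra : sigma_algebra setT (borel_seq V).
Proof. exact: smallest_sigma_algebra. Qed.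

Lemma borel_seq_coord i : @sigma_fun (nat -> V) (borel_seq V) V (fun v => v i).
Proof. by move=> u; apply: sub_sigma_algebra; exists i, u. Qed.

Lemma borel_geodesic {a : (nat -> V) -> nat -> V} :
  (forall i, @sigma_fun (nat -> V) (borel_seq V) V (fun v => a v i)) ->
  borel_seq V (fun v => geodesic V adj (a v)).
Proof.
have salg := borel_seq_sigma_algebra => Sa; rewrite /geodesic /injective.
apply: (sigma_and salg).
  apply: (sigma_forall salg) => i; apply: (sigma_forall salg) => j; apply: (sigma_imply salg).
    exact: (sigma_pred2 salg eq (Sa i) (Sa j)).
  exact: (sigma_const salg).
apply: (sigma_forall salg) => i.
exact: (sigma_pred2 salg (fun c d => adj c d) (Sa i) (Sa i.+1)).
Qed.

(** Over a representative [v], the ray is a finite sequence followed by a tail of [v]; only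
    countably many pairs [s], [m] arise, and each condition on them is Borel in the coordinates of
    [v]. *)
Lemma boundary_borel_ray n u : boundary_borel V adj [set x | ray x n = u].
Proof.
have salg := borel_seq_sigma_algebra.
have Sr s m i : @sigma_fun (nat -> V) (borel_seq V) V
    (fun v => prepend s (fun k => v (m + k)) i).
  exact: (sigma_fun_comp salg (fun c => nth c s i) (borel_seq_coord _)).
have : borel_seq V (fun v => geodesic V adj v /\
    exists s m, geodesic V adj (prepend s (fun k => v (m + k))) /\
      prepend s (fun k => v (m + k)) 0 = o /\ prepend s (fun k => v (m + k)) n = u).
  apply: (sigma_and salg); first exact: (borel_geodesic (a := id) borel_seq_coord).
  apply: (sigma_exists salg) => s; apply: (sigma_exists salg) => m; apply: (sigma_and salg).
    exact: borel_geodesic.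
  by apply: (sigma_and salg); apply: Sr.
rewrite /boundary_borel; congr borel_seq; apply/seteqP; split=> v /= [gv]; last first.
  case=> x [xn xv]; split=> //; have [s [m [gr r0]]] := geodesic_from o v gv.
  exists s, m; split=> //; split=> //.
  by rewrite -(ray_unique x _ v xv (prepend_tail_eq s v m) gr r0).
case=> s [m [gr [r0 rn]]]; split=> //.
pose x : boundary V adj := exist _ (tclass V adj v) (ex_intro _ v (conj gv erefl)).
by exists x; rewrite (ray_unique x _ v erefl (prepend_tail_eq s v m) gr r0).
Qed.

Lemma boundary_borel_setT : boundary_borel V adj setT.
Proof.
rewrite /boundary_borel; have := borel_geodesic (a := id) borel_seq_coord.
congr borel_seq; apply/seteqP; split=> v /=; last by case.
move=> gv; split=> //.
by exists (exist _ (tclass V adj v) (ex_intro _ v (conj gv erefl))).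
Qed.

Lemma boundary2_borel_fst i : @sigma_fun _ (boundary2_borel V adj) V (fun p => ray p.1 i).
Proof.
move=> u; apply: sub_sigma_algebra; exists [set x | ray x i = u], setT.
split; first exact: boundary_borel_ray.
by split; [exact: boundary_borel_setT | apply/seteqP; split=> p //= -[]].
Qed.

Lemma boundary2_borel_snd i : @sigma_fun _ (boundary2_borel V adj) V (fun p => ray p.2 i).
Proof.
move=> u; apply: sub_sigma_algebra; exists setT, [set x | ray x i = u].
split; first exact: boundary_borel_setT.
by split; [exact: boundary_borel_ray | apply/seteqP; split=> p //= -[]].
Qed.

End TreeGeodesics.

(** * Hyperfiniteness of the boundary action *)

Theorem theorem3p2 (G : countType) (mul : G -> G -> G) (one : G) (inv : G -> G)
    (V : countType) (adj : rel V) (act : G -> V -> V) :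
  is_group G mul one inv ->
  is_tree V adj ->
  is_action G V mul one act ->
  acts_by_automorphisms G V adj act ->
  (forall v : nat -> V, geodesic V adj v ->
     exists n, stab_segment G V act v n = stab_geo G V act v) ->
  boundary_borel_hyperfinite V adj (boundary_orbit_rel G V adj act).
Proof.
move=> groupG treeV actionG autG stabG.
have salg2 : sigma_algebra setT (boundary2_borel V adj) by exact: smallest_sigma_algebra.
(* Without a base vertex the boundary is empty. *)
case: (pselect (inhabited V)) => [[o]|noV]; last first.
  have noX (x : boundary V adj) : False by case: x => A [v _]; apply: noV; exists; exact: v 0.
  exists (fun _ _ _ => True); split=> //; split.
    by move=> i; apply: (sigma_const salg2).
  by split; [move=> i x; case: (noX x) | split=> // x; case: (noX x)].
pose r := ray treeV o.
have sf x : @stab_finite G V act (r x).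
  move=> t; have [injr adjr] := ray_geodesic treeV o x.
  have [|n eq_stab] := stabG (fun i => r x (t + i)).
    by split=> [i j /injr /addnI|i] //; rewrite addnS.
  (* The successor accounts for the vertex of index [n] in [stab_segment]. *)
  by exists n.+1 => g fixg; have : stab_segment G V act (fun i => r x (t + i)) n g;
    [exact: fixg | rewrite eq_stab].
have actTE x y : boundary_orbit_rel G V adj act x y <->
    exists m n, @tail_equiv G V act (r x) m (r y) n.
  split.
    move=> [g [v [gv [xv yv]]]].
    have : tail_eq V (r y) (fun k => act g (v k)).
      apply: tail_eq_sym; apply: tclass_tail_eq; first exact: ray_geodesic.
      by rewrite -yv (ray_tclass treeV o).
    have : tail_eq V (r x) v by apply: tclass_tail_eq gv _; rewrite -(ray_tclass treeV o).
    (* These positions make both rays follow [v] and its translate from index [n + q] on. *)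
    move=> [m [n xv']] [p [q yv']]; exists (m + q), (p + n), g => i.
    by rewrite -addnA xv' -addnA yv' addnCA.
  move=> [m [n [g gxy]]]; exists g, (r x); split; first exact: ray_geodesic.
  split; first exact: ray_tclass.
  by rewrite (ray_tclass treeV o); apply: tclass_eq; apply: tail_eq_sym; exists m, n.
pose F k x y := @marker_rel G V act k (r x) (r y).
pose K k x := @marker_index G V act k (r x).
have F_equiv k : is_equivalence (boundary V adj) (F k).
  have [Frefl [Fsym Ftrans]] := marker_rel_equiv groupG actionG k.
  by split; [move=> x | split; [move=> x y | move=> x y z]];
    [exact: Frefl | exact: Fsym | exact: Ftrans].
have F0 x y : F 0 x y -> x = y by move/ray_inj.
have F_succ k x y : F k x y -> F k.+1 x y by exact: (marker_rel_succ groupG actionG).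
have K_inv k x y : F k x y -> K k x = K k y.
  exact: (marker_index_invariant groupG actionG).
have K_sep k x y : F k.+1 x y -> K k x = K k y -> F k x y.
  by apply: (marker_index_separates groupG actionG).
exists (bounded_index_rel F K); split.
  by move=> n; apply: bounded_index_equiv.
split.
  move=> n; apply: (sigma_exists salg2) => m.
  have Sfst := boundary2_borel_fst treeV o; have Ssnd := boundary2_borel_snd treeV o.
  apply: (sigma_and salg2); first exact: sigma_const.
  apply: (sigma_and salg2); first exact: (sigma_marker_rel salg2 m Sfst Ssnd).
  apply: (sigma_forall salg2) => i; apply: (sigma_imply salg2); first exact: sigma_const.
  apply: (sigma_and salg2); apply: (sigma_fun_pred salg2 (fun k => k <= n)).
    exact: (sigma_marker_index salg2 Sfst).
  exact: (sigma_marker_index salg2 Ssnd).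
split; first by move=> n x; apply: bounded_index_finite.
split; first by move=> n x y; apply: bounded_index_succ.
move=> x y; rewrite actTE -(marker_rel_union groupG actionG (sf x)).
exact: bounded_index_union.
Qed.
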